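(* Let $C$ be a non-empty finite subset of $\mathbb{Z}$, let $M$ be a $C$-incentive and let $x\in{\rm msg}(M)$. Then $M\setminus\{x\}$ is a $C$-incentive if and only if $$\{x\}-C\subseteq(\mathbb{Z}\setminus M)\cup{\rm msg}(M\setminus\{x\})\cup\{x,0\}.$$
   Context: $\mathbb{N}$ denotes the non-negative integers. For $C\subseteq\mathbb{Z}$, a $C$-incentive is a submonoid $M$ of $(\mathbb{N},+)$ such that $s+t+c\in M$ for all $s,t\in M\setminus\{0\}$ and all $c\in C$. For a submonoid $M$ of $(\mathbb{N},+)$, ${\rm msg}(M)=(M\setminus\{0\})\setminus((M\setminus\{0\})+(M\setminus\{0\}))$ is its minimal system of generators; if $x\in{\rm msg}(M)$ then $M\setminus\{x\}$ is again a submonoid. $\{x\}-C=\{x-c : c\in C\}$. *)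

(* Defs.v *)
From mathcomp Require Import all_boot all_order all_algebra.
From mathcomp Require Import all_classical.

Set Implicit Arguments.
Unset Strict Implicit.
Unset Printing Implicit Defensive.

Local Open Scope classical_set_scope.
Local Open Scope ring_scope.

Definition submonoid (M : set nat) : Prop := GRing.nmod_closed (mem M).

Definition setZ (M : set nat) : set int := [set n%:Z | n in M].

(* The sum is taken in int because the elements of C may be negative. *)
Definition incentive (C : set int) (M : set nat) : Prop :=
  submonoid M /\
  forall (s t : nat) (c : int),
    (M `\ 0%N) s -> (M `\ 0%N) t -> C c -> setZ M (s%:Z + t%:Z + c).

Definition msg (M : set nat) : set nat :=
  (M `\ 0%N) `\` [set (s + t)%N | s in M `\ 0%N & t in M `\ 0%N].

(* Main.v *)
Require Import Defs.
From mathcomp Require Import all_boot all_order all_algebra.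
From mathcomp Require Import all_classical.
From mathcomp Require Import zify.

Local Open Scope classical_set_scope.
Local Open Scope ring_scope.

(** Removing [x] can break the incentive condition only where some [s + t + c] equals [x], that is,
    where [x - c] is a sum of two nonzero elements of $M\setminus\{x\}$. The set on the right-hand
    side consists of the integers that are not such sums: the nonzero elements of $M\setminus\{x\}$
    that are not are its minimal generators. *)

Lemma submonoidP (M : set nat) :
  submonoid M <-> M 0%N /\ (forall s t : nat, M s -> M t -> M (s + t)%N).
Proof.
split=> [[M0 MD]|[M0 MD]]; split.
- exact: set_mem M0.
- by move=> s t Ms Mt; apply: set_mem; apply: MD; apply: mem_set.
- exact: mem_set M0.
- by move=> s t Ms Mt; apply: mem_set; apply: MD; apply: set_mem.
Qed.

Lemma setZP (M : set nat) (n : nat) : setZ M n%:Z <-> M n.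
Proof. by split=> [[m Mm [<-]] //|Mn]; exists n. Qed.

(** A sum equal to [x] has a zero summand, and then the other is [x], or it contradicts the
    irreducibility of [x]. *)
Lemma submonoid_setD1 (M : set nat) (x : nat) :
  submonoid M -> msg M x -> submonoid (M `\ x).
Proof.
move=> /submonoidP[M0 MD] [[Mx x0] xirr]; apply/submonoidP; split.
  by split=> // /esym.
move=> s t [Ms sx] [Mt tx]; split; first exact: MD.
move=> /= stx.
have [s0|/eqP s0] := eqVneq s 0%N; first by apply: tx; rewrite /= -stx s0.
have [t0|/eqP t0] := eqVneq t 0%N.
  by apply: sx; rewrite /= -stx t0 addn0.
by apply: xirr; exists s => //; exists t.
Qed.

Theorem proposition6p2 (C : set int) (M : set nat) (x : nat) :
  C !=set0 -> finite_set C -> incentive C M -> msg M x ->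
  (incentive C (M `\ x) <->
   [set x%:Z - c | c in C] `<=`
     (~` setZ M) `|` setZ (msg (M `\ x)) `|` [set x%:Z; 0]).
Proof.
move=> _ _ [Msub Minc] xmsg.
have [_ MD] := (submonoidP M).1 Msub.
have xirr := xmsg.2.
split=> [[_ Dinc] _ [c Cc <-]|sub].
  have [[y My ycx]|nM] := pselect (setZ M (x%:Z - c)); last by left; left.
  have [yx|/eqP yx] := eqVneq y x; first by right; left; rewrite -ycx yx.
  have [y0|/eqP y0] := eqVneq y 0%N; first by right; right; rewrite /= -ycx y0.
  left; right; rewrite -ycx; apply/setZP; split; first by [].
  move=> [s Ds [t Dt sty]].
  have := Dinc s t c Ds Dt Cc.
  (* Decomposing [x - c] as [s + t] would force [x] itself into $M\setminus\{x\}$. *)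
  have -> : s%:Z + t%:Z + c = x%:Z by lia.
  by move=> /setZP[_]; apply.
split; first exact: submonoid_setD1.
move=> s t c Ds Dt Cc.
have [[Ms _] s0] := Ds; have [[Mt _] t0] := Dt.
have [m Mm mE] := Minc s t c (conj Ms s0) (conj Mt t0) Cc.
(* The incentive property of [M] leaves only the value [x] to exclude. *)
exists m => //; split=> // /= mx.
have stE : x%:Z - c = (s + t)%N%:Z by lia.
have := sub (x%:Z - c); rewrite stE => /(_ (ex_intro2 _ _ c Cc stE)).
(* All four cases fail: [s + t] lies in [M], is decomposable in $M\setminus\{x\}$, differs from the
   irreducible [x], and is nonzero. *)
move=> [[nM|/setZP[_]]|[[stx]|[]]].
- by apply: nM; apply/setZP; exact: MD.
- by apply; exists s => //; exists t.
- by apply: xirr; exists s => //; exists t.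
- by rewrite /= in s0; lia.
Qed.
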